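(* Let $f,g\in\mathbb{Z}[X]$ be nonconstant polynomials, let $\theta_{1},\dots,\theta_{n}$ and $\xi_{1},\dots,\xi_{m}$ be the complex roots (listed with multiplicity) of $f$ and $g$, respectively, where $n=\deg f$ and $m=\deg g$. Assume that $\theta_{1}\cdots\theta_{n}\xi_{1}\cdots\xi_{m}\neq 0$, and that $|Res(f,g)|=p\cdot q$, where $p$ is a prime number and $q$ is a positive integer. If $$\min_{i,j}|\theta_{i}-\xi_{j}|>q^{1/\min(m,n)}\quad\text{or}\quad \min_{i,j}\left|\frac{1}{\theta_{i}}-\frac{1}{\xi_{j}}\right|>q^{1/\min(m,n)},$$ then both $f$ and $g$ are irreducible over $\mathbb{Q}$.
   Context: $Res(f,g)$ is the resultant of $f$ and $g$. *)

(* Defs.v *)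
From HB Require Import structures.
From mathcomp Require Import all_boot all_order all_algebra.
From mathcomp Require Import reals.
From mathcomp Require Import complex.

Set Implicit Arguments.
Unset Strict Implicit.
Unset Printing Implicit Defensive.

Import Order.TTheory GRing.Theory Num.Theory.
Local Open Scope ring_scope.

(* Minimum of a nonempty sequence (the value at [::] is the junk value 0). It
   is only applied to norms; in a numDomainType these are nonnegative elements,
   hence pairwise comparable, although the order on R[i] is only partial. *)
Definition seq_min (C : numDomainType) (s : seq C) : C :=
  \big[Num.min/head 0 s]_(x <- s) x.

Definition min_dist (C : numDomainType) (s t : seq C) : C :=
  seq_min [seq `|x - y| | x <- s, y <- t].

Definition min_dist_inv (C : numFieldType) (s t : seq C) : C :=
  seq_min [seq `|x^-1 - y^-1| | x <- s, y <- t].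

(* For f != 0: since f splits as its leading coefficient times the product, s
   lists all the roots of f in C, each as often as its multiplicity. *)
Definition lists_roots (C : fieldType) (f : {poly int}) (s : seq C) : Prop :=
  map_poly intr f = (lead_coef f)%:~R *: \prod_(x <- s) ('X - x%:P).

(* Main.v *)
Require Import Defs.
From HB Require Import structures.
From mathcomp Require Import all_boot all_order all_algebra.
From mathcomp Require Import reals.
From mathcomp Require Import complex.
From mathcomp Require Import zify ring.

Set Implicit Arguments.
Unset Strict Implicit.
Unset Printing Implicit Defensive.

Import Order.TTheory GRing.Theory Num.Theory.
Local Open Scope ring_scope.

(** Suppose that f = f1 * f2 with f1 and f2 nonconstant; by Gauss's lemma f1
    and f2 may be taken in Z[X]. The resultant is multiplicative, so
    p q = |Res(g, f1)| |Res(g, f2)|, and since p is prime it divides one factor,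
    which makes the other a positive divisor of q, hence at most q. The theorem
    follows because every nonconstant divisor f1 of f has |Res(g, f1)| > q:

    - with x running over the roots of f1 and y over those of g,
      |Res(g, f1)| = |lc f1|^(deg g) |lc g|^(deg f1) prod |x - y|
      ([norm_resultant]); the leading coefficients are nonzero integers, so the
      product alone is a lower bound. It has deg f1 * deg g >= min(m, n)
      factors, each larger than q^(1/min(m, n)) >= 1, and so it exceeds q.

    - since x - y = x y (1/y - 1/x), the same resultant is
      |f1(0)|^(deg g) |g(0)|^(deg f1) prod |1/x - 1/y| ([norm_resultant_inv]),
      and the nonzero integers f1(0) and g(0) replace the leading coefficients.

    Both the root formula and the multiplicativity rest on
    Res(g, (X - a) f) = g(a) Res(g, f) ([resultant_mul_XsubC]), which holds
    because division by X - a makes the Sylvester matrix block triangular. The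
    argument for g is the same, as |Res(f, g)| = |Res(g, f)|. *)

(** * Sylvester determinants and linear factors *)

(** Row families are indexed by nat rather than by ordinals, so that the rows of
    Sylvester matrices of different sizes can be compared without casts. *)
Definition coef_mx (A : nzRingType) (n : nat) (r : nat -> {poly A}) : 'M[A]_n :=
  \matrix_(i, j) (r i)`_j.

Definition Sylvester_row (A : nzRingType) (p q : {poly A}) (i : nat) :
    {poly A} :=
  if (i < (size q).-1)%N then 'X^i * p else 'X^(i - (size q).-1) * q.

Lemma resultantE (A : nzRingType) (p q : {poly A}) :
  resultant p q =
  \det (coef_mx ((size q).-1 + (size p).-1) (Sylvester_row p q)).
Proof.
congr (\det _); apply/matrixP => i j; rewrite Sylvester_mxE mxE /Sylvester_row.
case: splitP => k def_i; rewrite def_i.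
  by rewrite coefXnM ltnNge; case: leqP.
by rewrite addKn coefXnM ltnNge; case: leqP.
Qed.

Lemma resultant_map (A B : nzRingType) (h : {rmorphism A -> B})
    (p q : {poly A}) : injective h ->
  resultant (map_poly h p) (map_poly h q) = h (resultant p q).
Proof.
move=> h_inj; rewrite !resultantE -det_map_mx.
rewrite !(size_map_inj_poly h_inj (rmorph0 h)).
congr (\det _); apply/matrixP => i j; rewrite !mxE /Sylvester_row.
rewrite (size_map_inj_poly h_inj (rmorph0 h)).
by case: ifP => _; rewrite !coefXnM !coef_map; case: ifP; rewrite ?rmorph0.
Qed.

Lemma sum_mulrb_eq (V : nmodType) (n : nat) (F : 'I_n -> V) (j : 'I_n) :
  \sum_(k < n) F k *+ (k == j :> nat) = F j.
Proof.
rewrite (bigD1 j) //= eqxx mulr1n big1 ?addr0 // => k k_neq_j.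
by rewrite -(inj_eq val_inj) in k_neq_j; rewrite (negPf k_neq_j).
Qed.

(** These simultaneous row operations are left multiplication by a unipotent
    lower triangular matrix L. *)
Lemma det_coef_mx_row_sub (A : comNzRingType) (n : nat) (c : nat -> A)
    (r : nat -> {poly A}) :
  \det (coef_mx n (fun i => if i is k.+1 then r i - c k *: r k else r i)) =
  \det (coef_mx n r).
Proof.
pose L := \matrix_(i < n, k < n) ((i == k :> nat)%:R - c k *+ (k.+1 == i)).
have detL : \det L = 1.
  rewrite det_trig; last first.
    apply/is_trig_mxP => i j lt_ij; rewrite mxE ltn_eqF // gtn_eqF ?subr0 //.
    exact: ltnW.
  by apply: big1 => i _; rewrite mxE eqxx gtn_eqF ?subr0.
rewrite -[RHS]mul1r -detL -det_mulmx; congr (\det _).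
apply/matrixP => i j; rewrite !mxE.
transitivity (\sum_(k < n) ((r k)`_j *+ (k == i :> nat)
                            - (c k * (r k)`_j) *+ (k.+1 == i))); last first.
  by apply: eq_bigr => k _; rewrite !mxE mulrBl mulr_natl mulrnAl eq_sym.
rewrite sumrB sum_mulrb_eq.
case: i => [[|i] lt_in] /=.
  by rewrite big1 ?subr0 // => k _; rewrite mulr0n.
rewrite coefB coefZ; congr (_ - _).
by rewrite (sum_mulrb_eq (fun k => c k * (r k)`_j) (Ordinal (ltnW lt_in))).
Qed.

(** In the basis 1, X - a, X (X - a), X^2 (X - a), ... (the rows of the
    unipotent matrix B below) a multiple (X - a) r_k has no component along 1
    and the coefficients of r_k along the rest, while h has component h(a)
    along 1. The matrix N of these coordinates is therefore block triangular
    with diagonal blocks h(a) and the coefficients of the r_k. *)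
Lemma det_coef_mx_mul_XsubC (A : comNzRingType) (n : nat) (a : A)
    (h : {poly A}) (r : nat -> {poly A}) :
    (size h <= n.+1)%N -> (forall i, (i < n)%N -> (size (r i) <= n)%N) ->
  \det (coef_mx n.+1 (fun i => if i is k.+1 then ('X - a%:P) * r k else h)) =
  h.[a] * \det (coef_mx n r).
Proof.
move=> size_h size_r.
have [h' def_h] : exists h', h = h.[a]%:P + ('X - a%:P) * h'.
  have /factor_theorem[h' def_h'] : root (h - h.[a]%:P) a.
    by rewrite rootE !hornerE subrr.
  by exists h'; rewrite mulrC -def_h' addrC subrK.
have size_h' : (size h' <= n)%N.
  have [->|h'_neq0] := eqVneq h' 0; first by rewrite size_poly0.
  have size_p : size (('X - a%:P) * h') = (size h').+1.
    by rewrite size_monicM ?monicXsubC // size_XsubC.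
  rewrite -ltnS -size_p.
  have -> : ('X - a%:P) * h' = h - h.[a]%:P.
    by rewrite {1}def_h [RHS]addrC addKr.
  rewrite (leq_trans (size_polyD _ _)) // geq_max size_h size_polyN.
  by rewrite (leq_trans (size_polyC_leq1 _)).
pose N : 'M[A]_(1 + n) :=
  block_mx h.[a]%:M (\row_j h'`_j) 0 (coef_mx n r).
pose B : 'M[A]_(1 + n) :=
  \matrix_(k, j) ((j == k :> nat)%:R - a *+ (j.+1 == k)).
have detB : \det B = 1.
  rewrite det_trig; last first.
    apply/is_trig_mxP => i j lt_ij.
    rewrite mxE (gtn_eqF lt_ij) gtn_eqF ?subr0 //.
    exact: ltnW.
  by apply: big1 => i _; rewrite mxE eqxx gtn_eqF ?subr0.
have detN : \det N = h.[a] * \det (coef_mx n r).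
  by rewrite det_ublock det_scalar1.
rewrite -detN -[RHS]mulr1 -detB -det_mulmx; congr (\det _).
(* Row i of N, as a polynomial, is e i along 1 and s i along the rest. *)
pose s i := if i is k.+1 then r k else h'.
pose e i := if i is k.+1 then 0 else h.[a].
have size_s (i : 'I_n.+1) : (size (s i) <= n)%N.
  by case: i => [[|i] lt_in] //=; apply: size_r.
have NE (i j : 'I_(1 + n)) :
    N i j = (if j : nat is k.+1 then (s i)`_k else e i).
  rewrite !mxE.
  by case: splitP => i' ->; rewrite mxE; case: splitP => j' ->;
    rewrite ?ord1 ?mxE ?ord1.
apply/matrixP => i j; rewrite mxE mxE.
transitivity (\sum_(k < 1 + n) (N i k *+ (k == j :> nat)
                            - (a * N i k) *+ (j.+1 == k))); last first.
  apply: eq_bigr => k _; rewrite [B _ _]mxE mulrBr mulr_natr mulrnAr eq_sym.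
  by rewrite (mulrC a).
rewrite sumrB sum_mulrb_eq NE.
have -> : \sum_(k < 1 + n) (a * N i k) *+ (j.+1 == k) = a * (s i)`_j.
  have [lt_jn|le_nj] := ltnP j n.
    have lt_jn1 : (j.+1 < 1 + n)%N by [].
    under eq_bigr do rewrite eq_sym.
    by rewrite (sum_mulrb_eq _ (Ordinal lt_jn1)) NE.
  rewrite (nth_default _ (leq_trans (size_s i) le_nj)) mulr0 big1 // => k _.
  by rewrite gtn_eqF ?mulr0n // (leq_trans (ltn_ord k)).
have -> : (if i : nat is k.+1 then ('X - a%:P) * r k else h) =
          (e i)%:P + ('X - a%:P) * s i.
  by case: (i : nat) => [|k] //=; rewrite add0r.
rewrite coefD coefC mulrBl coefB coefXM coefCM.
by case: (j : nat) => [|k] /=; rewrite ?sub0r ?add0r.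
Qed.

Lemma size_Sylvester_row (A : nzRingType) (p q : {poly A}) (i : nat) :
    (i < (size q).-1 + (size p).-1)%N ->
  (size (Sylvester_row p q i) <= (size q).-1 + (size p).-1)%N.
Proof.
rewrite /Sylvester_row => lt_i.
case: ltnP => cmp_i; apply: leq_trans (size_polyMleq _ _) _;
  rewrite size_polyXn /=.
all: by move: (size p) (size q) lt_i cmp_i => sp sq lt_i cmp_i; lia.
Qed.

(** The Sylvester matrix of g and (X - a) f has the rows X^k g for k <= deg f,
    followed by multiples of (X - a) f. Subtracting from each X^(k+1) g the
    multiple a X^k g of the previous row leaves g itself and multiples of X - a,
    whose cofactors are the rows of the Sylvester matrix of g and f. Having g as
    the first argument puts its row on top, so that no sign appears. *)
Lemma resultant_mul_XsubC (A : comNzRingType) (g f : {poly A}) (a : A) :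
  f != 0 -> resultant g (('X - a%:P) * f) = g.[a] * resultant g f.
Proof.
move=> f_neq0; set n := (size f).-1; set m := (size g).-1.
have size_f : size f = n.+1 by rewrite /n prednK ?size_poly_gt0.
have size_Xf : size (('X - a%:P) * f) = n.+2.
  by rewrite size_monicM ?monicXsubC // size_XsubC size_f.
rewrite !resultantE size_Xf /= addSn.
(* Rows 1 to n are X^i g with i > 0; those below already contain X - a. *)
rewrite -(det_coef_mx_row_sub _ (fun k => if (k < n)%N then a else 0)).
rewrite -det_coef_mx_mul_XsubC -/n -/m; first last.
- by move=> i; apply: size_Sylvester_row.
- by rewrite (leq_trans (leqSpred _)) // ltnS leq_addl.
congr (\det _); apply/matrixP => i j; rewrite !mxE; congr ((polyseq _)`_j).
rewrite /Sylvester_row size_Xf /= -/n.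
case: (i : nat) => [|k]; first by rewrite expr0 mul1r.
rewrite ltnS; case: ltnP => [lt_kn|le_nk].
  rewrite ltnS (ltnW lt_kn) -mul_polyC exprS; ring.
rewrite scale0r subr0 subSS; ring.
Qed.

Lemma resultant_polyC (A : comNzRingType) (g : {poly A}) (c : A) :
  resultant g c%:P = c ^+ (size g).-1.
Proof.
rewrite resultantE size_polyC; set m := (size g).-1.
have -> : (c != 0).-1 = 0 by case: (c != 0).
rewrite add0n -[RHS]mulr1 -(det1 A m) -detZ.
congr (\det _); apply/matrixP => i j.
rewrite !mxE /Sylvester_row size_polyC.
have -> : (c != 0).-1 = 0 by case: (c != 0).
by rewrite ltn0 subn0 coefMC coefXn mulr_natl mulr_natr eq_sym.
Qed.

Lemma resultant_split_r (A : idomainType) (g : {poly A}) (c : A)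
    (s : seq A) : c != 0 ->
  resultant g (c *: \prod_(x <- s) ('X - x%:P)) =
  c ^+ (size g).-1 * \prod_(x <- s) g.[x].
Proof.
move=> c_neq0; elim: s => [|x s IHs].
  by rewrite !big_nil alg_polyC resultant_polyC mulr1.
rewrite !big_cons scalerAr resultant_mul_XsubC ?IHs 1?mulrCA //.
by rewrite -size_poly_gt0 size_scale ?size_prod_XsubC.
Qed.

(** * Resultants of integer polynomials in terms of their roots *)

Lemma lists_roots_size (C : numFieldType) (f : {poly int}) (s : seq C) :
  f != 0 -> lists_roots f s -> size f = (size s).+1.
Proof.
move=> f_neq0 roots_f.
rewrite -(size_map_inj_poly (@intr_inj C) (rmorph0 _)) roots_f.
by rewrite size_scale ?size_prod_XsubC // intr_eq0 lead_coef_eq0.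
Qed.

Lemma lists_roots_horner (C : numFieldType) (f : {poly int}) (s : seq C)
    (x : C) : lists_roots f s ->
  (map_poly intr f).[x] = (lead_coef f)%:~R * \prod_(z <- s) (x - z).
Proof.
move=> ->; rewrite hornerZ horner_prod; congr (_ * _).
by apply: eq_bigr => z _; rewrite hornerXsubC.
Qed.

Lemma lists_roots_root (C : numFieldType) (f : {poly int}) (s : seq C)
    (x : C) : f != 0 -> lists_roots f s ->
  root (map_poly intr f) x = (x \in s).
Proof.
move=> f_neq0 ->; rewrite rootZ ?root_prod_XsubC //.
by rewrite intr_eq0 lead_coef_eq0.
Qed.

Lemma lists_rootsM (C : numFieldType) (f1 f2 : {poly int}) (s1 s2 : seq C) :
  lists_roots f1 s1 -> lists_roots f2 s2 -> lists_roots (f1 * f2) (s1 ++ s2).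
Proof.
rewrite /lists_roots => roots_f1 roots_f2.
rewrite rmorphM /= roots_f1 roots_f2 big_cat lead_coefM rmorphM /=.
by rewrite -scalerAl -scalerAr scalerA.
Qed.

Lemma lists_roots_exists (C : numClosedFieldType) (f : {poly int}) :
  exists s : seq C, lists_roots f s.
Proof.
have [s def_f] := closed_field_poly_normal (map_poly intr f : {poly C}).
exists s; rewrite /lists_roots {1}def_f lead_coef_map_inj //.
exact: intr_inj.
Qed.

Lemma resultant_lists_roots (C : numFieldType) (f g : {poly int})
    (s : seq C) : f != 0 -> lists_roots f s ->
  (resultant g f)%:~R =
  (lead_coef f)%:~R ^+ (size g).-1 * \prod_(x <- s) (map_poly intr g).[x].
Proof.
move=> f_neq0 roots_f; rewrite -resultant_map; last exact: intr_inj.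
rewrite roots_f resultant_split_r ?intr_eq0 ?lead_coef_eq0 //.
by rewrite (size_map_inj_poly (@intr_inj C) (rmorph0 _)).
Qed.

Lemma norm_resultant (C : numFieldType) (f g : {poly int}) (s t : seq C) :
    f != 0 -> g != 0 -> lists_roots f s -> lists_roots g t ->
  `|(resultant g f)%:~R : C| =
  `|(lead_coef f)%:~R| ^+ size t * `|(lead_coef g)%:~R| ^+ size s *
  \prod_(x <- s) \prod_(y <- t) `|x - y|.
Proof.
move=> f_neq0 g_neq0 roots_f roots_g.
rewrite (resultant_lists_roots _ f_neq0 roots_f).
rewrite (lists_roots_size g_neq0 roots_g) /= normrM normrX -mulrA.
rewrite normr_prod; congr (_ * _).
under eq_bigr do rewrite (lists_roots_horner _ roots_g) normrM normr_prod.
by rewrite big_split big_const_seq count_predT iter_mulr_1.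
Qed.

Lemma norm_resultantC (C : numFieldType) (f g : {poly int}) (s t : seq C) :
    f != 0 -> g != 0 -> lists_roots f s -> lists_roots g t ->
  `|resultant f g|%N = `|resultant g f|%N.
Proof.
move=> f_neq0 g_neq0 roots_f roots_g.
apply/eqP; rewrite -(eqr_nat C) !natr_absz !intr_norm.
rewrite (norm_resultant f_neq0 g_neq0 roots_f roots_g).
rewrite (norm_resultant g_neq0 f_neq0 roots_g roots_f).
rewrite exchange_big /= (mulrC (_ ^+ _)); apply/eqP; congr (_ * _).
by apply: eq_bigr => x _; apply: eq_bigr => y _; apply: distrC.
Qed.

(** C serves only as a field where f1 and f2 split: the root formula turns the
    product of polynomials into concatenation of root lists. *)
Lemma resultantMr (C : numClosedFieldType) (g f1 f2 : {poly int}) :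
  f1 != 0 -> f2 != 0 ->
  resultant g (f1 * f2) = resultant g f1 * resultant g f2.
Proof.
move=> f1_neq0 f2_neq0.
have [s1 roots1] := lists_roots_exists C f1.
have [s2 roots2] := lists_roots_exists C f2.
apply: (@intr_inj C).
have roots12 := lists_rootsM roots1 roots2.
rewrite intrM (resultant_lists_roots _ _ roots12) ?mulf_neq0 //.
rewrite (resultant_lists_roots _ _ roots1) //.
rewrite (resultant_lists_roots _ _ roots2) //.
rewrite big_cat lead_coefM rmorphM exprMn /=; ring.
Qed.

(** Up to sign, f(0) is the leading coefficient times the product of the roots,
    so the factor x y in x - y = x y (1/y - 1/x) turns leading coefficients into
    constant terms. *)
Lemma norm_resultant_inv (C : numFieldType) (f g : {poly int})
    (s t : seq C) :
    f != 0 -> g != 0 -> lists_roots f s -> lists_roots g t ->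
    (forall x, x \in s -> x != 0) -> (forall y, y \in t -> y != 0) ->
  `|(resultant g f)%:~R : C| =
  `|(f.[0])%:~R| ^+ size t * `|(g.[0])%:~R| ^+ size s *
  \prod_(x <- s) \prod_(y <- t) `|x^-1 - y^-1|.
Proof.
move=> f_neq0 g_neq0 roots_f roots_g s_neq0 t_neq0.
have norm0 h r : lists_roots h r ->
    `|(h.[0])%:~R : C| = `|(lead_coef h)%:~R| * \prod_(z <- r) `|z|.
  move=> roots_h; rewrite -horner_map rmorph0 (lists_roots_horner _ roots_h).
  rewrite normrM normr_prod; congr (_ * _).
  by apply: eq_bigr => z _; rewrite sub0r normrN.
rewrite (norm_resultant f_neq0 g_neq0 roots_f roots_g).
rewrite (norm0 _ _ roots_f) (norm0 _ _ roots_g) !exprMn.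
have -> : \prod_(x <- s) \prod_(y <- t) `|x - y| =
    (\prod_(x <- s) `|x|) ^+ size t * (\prod_(y <- t) `|y|) ^+ size s *
    \prod_(x <- s) \prod_(y <- t) `|x^-1 - y^-1|.
  rewrite -prodrXl -[X in _ * X * _]iter_mulr_1 -(count_predT s) -big_const_seq.
  rewrite -!big_split /=; apply: eq_big_seq => x s_x.
  rewrite -[X in X * _ * _]iter_mulr_1 -(count_predT t) -big_const_seq.
  rewrite -!big_split /=; apply: eq_big_seq => y t_y.
  have -> : x - y = x * y * (y^-1 - x^-1).
    by field; rewrite s_neq0 ?t_neq0.
  by rewrite !normrM [in LHS]distrC.
ring.
Qed.

(** * Separated roots force large resultants *)

Lemma ltr_exp_prod (C : numDomainType) (b : C) (k : nat) (s : seq C) :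
    1 <= b -> (0 < k <= size s)%N -> (forall x, x \in s -> b < x) ->
  b ^+ k < \prod_(x <- s) x.
Proof.
move=> b_ge1; elim: s k => [|x s IHs] [|k] //= le_ks b_lt.
have b_gt0 : 0 < b by apply: lt_le_trans b_ge1.
have bx : b < x by rewrite b_lt ?mem_head.
have IHb y : y \in s -> b < y by move=> sy; rewrite b_lt // inE sy orbT.
have prod_ge1 : 1 <= \prod_(y <- s) y.
  rewrite big_seq; apply: (big_ind (fun z => 1 <= z)) => // [u v|y /IHb].
    exact: mulr_ege1.
  by move/ltW; apply: le_trans.
rewrite big_cons exprS; case: k => [|k] in le_ks *.
  rewrite expr0 mulr1 (lt_le_trans bx) // ler_peMr //.
  by rewrite ltW // (lt_trans b_gt0).
by rewrite ltr_pM ?IHs ?(ltW b_gt0) ?exprn_ge0 ?(ltW b_gt0).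
Qed.

(** The second alternative carries the nonvanishing of the roots because its
    lower bound needs nonzero constant terms, and 0^-1 is 0 by convention. Being
    a condition on pairs of members, it passes to the roots of a divisor. *)
Definition separated (C : numFieldType) (b : C) (s t : seq C) : Prop :=
  (forall x y, x \in s -> y \in t -> b < `|x - y|) \/
  (forall x y, x \in s -> y \in t ->
     [/\ x != 0, y != 0 & b < `|x^-1 - y^-1|]).

Lemma separated_sym (C : numFieldType) (b : C) (s t : seq C) :
  separated b s t -> separated b t s.
Proof.
case=> far; [left | right] => x y tx sy; first by rewrite distrC far.
by have [y0 x0] := far y x sy tx; rewrite distrC.
Qed.

(** In both formulas for |Res(g, f)| the factor in front of the product is a
    product of absolute values of nonzero integers, hence at least 1. *)
Lemma ltr_exp_norm_resultant (C : numFieldType) (f g : {poly int})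
    (s t : seq C) (b : C) (k : nat) :
    f != 0 -> g != 0 -> lists_roots f s -> lists_roots g t ->
    (0 < k <= size t)%N -> (0 < size s)%N ->
    1 <= b -> separated b s t ->
  b ^+ k < `|resultant g f|%N%:R.
Proof.
move=> f_neq0 g_neq0 roots_f roots_g /andP[k_gt0 le_kt] s_gt0 b_ge1 far.
have norm_ge1 (z : int) : z != 0 -> 1 <= `|z%:~R : C|.
  by move=> z_neq0; rewrite -intr_norm -natr_absz ler1n absz_gt0.
have le_k : (0 < k <= size s * size t)%N.
  by rewrite k_gt0 (leq_trans le_kt) // leq_pmull.
have lt_prod F : (forall x y, x \in s -> y \in t -> b < F x y) ->
    b ^+ k < \prod_(x <- s) \prod_(y <- t) F x y.
  move=> lt_bF; have <- : \prod_(z <- [seq F x y | x <- s, y <- t]) z =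
      \prod_(x <- s) \prod_(y <- t) F x y by apply: big_allpairs_dep.
  apply: ltr_exp_prod; rewrite ?size_allpairs // => _ /allpairsP[z [sz tz ->]].
  exact: lt_bF.
rewrite natr_absz intr_norm.
case: far => far.
  rewrite (norm_resultant f_neq0 g_neq0 roots_f roots_g).
  rewrite (lt_le_trans (lt_prod _ far)) // ler_peMl //; last first.
    by rewrite mulr_ege1 ?exprn_ege1 ?norm_ge1 ?lead_coef_eq0.
  by apply: prodr_ge0 => x _; apply: prodr_ge0.
have [x0 s_x0] : exists x0, x0 \in s.
  by case: (s) s_gt0 => // z r; exists z; rewrite mem_head.
have [y0 t_y0] : exists y0, y0 \in t.
  by case: (t) (leq_trans k_gt0 le_kt) => // z r; exists z; rewrite mem_head.
have s_neq0 x : x \in s -> x != 0 by move=> sx; have [] := far x y0 sx t_y0.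
have t_neq0 y : y \in t -> y != 0 by move=> ty; have [] := far x0 y s_x0 ty.
have at0_neq0 (h : {poly int}) (r : seq C) : h != 0 -> lists_roots h r ->
    (forall z, z \in r -> z != 0) -> h.[0] != 0.
  move=> h_neq0 roots_h r_neq0; rewrite -(intr_eq0 C).
  rewrite -(@horner_map _ _ intr) rmorph0 -rootE.
  rewrite (lists_roots_root _ h_neq0 roots_h).
  by apply/negP => /r_neq0; rewrite eqxx.
rewrite (norm_resultant_inv f_neq0 g_neq0 roots_f roots_g) //.
have far_lt x y : x \in s -> y \in t -> b < `|x^-1 - y^-1|.
  by move=> sx ty; have [] := far x y sx ty.
rewrite (lt_le_trans (lt_prod _ far_lt)) // ler_peMl //.
  by apply: prodr_ge0 => x _; apply: prodr_ge0.
rewrite mulr_ege1 ?exprn_ege1 ?norm_ge1 //.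
  exact: at0_neq0 roots_f s_neq0.
exact: at0_neq0 roots_g t_neq0.
Qed.

(** * Irreducibility *)

(** The roots of a divisor of f remain separated from those of g, so both
    factors of a nontrivial factorization would have a resultant with g larger
    than q, whereas one of these resultants divides q. *)
Lemma irreducible_of_separated (C : numClosedFieldType) (f g : {poly int})
    (s t : seq C) (p q k : nat) :
    (1 < size f)%N -> g != 0 -> lists_roots f s -> lists_roots g t ->
    (0 < k <= size t)%N -> prime p -> (0 < q)%N ->
    `|resultant g f|%N = (p * q)%N -> separated (k.-root q%:R) s t ->
  irreducible_poly (map_poly intr f : {poly rat}).
Proof.
move=> size_f g_neq0 roots_f roots_g k_bounds p_prime q_gt0 res_gf far.
have k_gt0 : (0 < k)%N by case/andP: k_bounds.
have f_neq0 : f != 0 by rewrite -size_poly_gt0 ltnW.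
have lt_factor f1 f2 : f = f1 * f2 -> (1 < size f1)%N ->
    (q < `|resultant g f1|)%N.
  move=> def_f size_f1.
  have f1_neq0 : f1 != 0 by rewrite -size_poly_gt0 ltnW.
  have [s1 roots1] := lists_roots_exists C f1.
  have sub_s1 x : x \in s1 -> x \in s.
    rewrite -(lists_roots_root _ f1_neq0 roots1).
    rewrite -(lists_roots_root _ f_neq0 roots_f) def_f rmorphM /= rootM.
    by move=> ->.
  rewrite -(ltr_nat C) -[q%:R](rootCK k_gt0).
  apply: (ltr_exp_norm_resultant f1_neq0 g_neq0 roots1 roots_g) => //.
  - by rewrite -ltnS -(lists_roots_size f1_neq0 roots1).
  - by rewrite rootC_ge1 // ler1n.
  - by case: far => far; [left | right] => x y /sub_s1; apply: far.
split=> [|h size_h dvd_h]; first by rewrite size_rat_int_poly.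
have [f1 [a a_neq0 def_h] [f2 def_f]] := dvdpP_rat_int dvd_h.
have := f_neq0; rewrite {1}def_f mulf_eq0 negb_or => /andP[f1_neq0 f2_neq0].
have size_hE : size h = size f1 by rewrite def_h size_scale ?size_rat_int_poly.
rewrite -dvdp_size_eqp // size_hE size_rat_int_poly def_f size_mul //.
have [/eqP size_f2|] := boolP (size f2 == 1); first by rewrite size_f2 addn1.
move=> size_f2; exfalso.
have lt1 : (1 < size f1)%N.
  by rewrite ltn_neqAle eq_sym -size_hE size_h size_hE size_poly_gt0.
have lt2 : (1 < size f2)%N by rewrite ltn_neqAle eq_sym size_f2 size_poly_gt0.
have lt_res1 := lt_factor _ _ def_f lt1.
have lt_res2 := lt_factor f2 f1 (etrans def_f (mulrC _ _)) lt2.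
have res12 : (`|resultant g f1| * `|resultant g f2|)%N = (p * q)%N.
  by rewrite -abszM -(resultantMr C) // -def_f.
have p_gt0 := prime_gt0 p_prime.
have : (p %| `|resultant g f1| * `|resultant g f2|)%N.
  by rewrite res12 dvdn_mulr.
have no_dvd (u v : nat) :
    (q < v)%N -> (u * v)%N = (p * q)%N -> (p %| u)%N -> False.
  move=> lt_qv def_uv /dvdnP[w def_u].
  have /eqP : (p * (w * v) = p * q)%N by rewrite -def_uv def_u mulnCA mulnA.
  rewrite eqn_pmul2l // => /eqP def_q.
  by move: lt_qv; rewrite ltnNge dvdn_leq // -def_q dvdn_mull.
rewrite Euclid_dvdM // => /orP[]; first exact: no_dvd lt_res2 res12.
by apply: no_dvd lt_res1 _; rewrite mulnC.
Qed.

(** The order of C need not be total: comparability of the entries is what makes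
    [Num.min] a lower bound. *)
Lemma seq_min_le (C : numDomainType) (s : seq C) (x : C) :
  (forall y, y \in s -> y \is Num.real) -> x \in s -> seq_min s <= x.
Proof.
move=> s_real s_x; rewrite /seq_min.
have x0_real : head 0 s \is Num.real.
  by case: s s_real {s_x} => [|z s] s_real; rewrite ?real0 //= s_real ?mem_head.
move: (head 0 s) x0_real => x0 x0_real.
have min_real (r : seq C) : (forall y, y \in r -> y \is Num.real) ->
    \big[Num.min/x0]_(y <- r) y \is Num.real.
  move=> r_real; rewrite big_seq.
  apply: (big_ind (fun z => z \is Num.real)) => //.
  by move=> u v; apply: min_real.
elim: s => //= z s IHs in s_real s_x *.
have s'_real y : y \in s -> y \is Num.real.
  by move=> sy; rewrite s_real // inE sy orbT.
rewrite big_cons comparable_ge_min ?real_comparable ?min_real ?s_real //.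
  by move: s_x; rewrite inE => /predU1P[->|/IHs->]; rewrite ?lexx ?orbT.
exact: mem_head.
Qed.

Theorem corollary2p4 (R : realType) (n m : nat) (f g : {poly int})
    (theta : n.-tuple R[i]) (xi : m.-tuple R[i]) (p q : nat)
    (n_gt0 : (0 < n)%N) (m_gt0 : (0 < m)%N)
    (deg_f : size f = n.+1) (deg_g : size g = m.+1)
    (roots_f : lists_roots f theta) (roots_g : lists_roots g xi)
    (roots_neq0 : (\prod_(t <- theta) t) * (\prod_(x <- xi) x) != 0)
    (p_prime : prime p) (q_gt0 : (0 < q)%N)
    (res_fg : `|resultant f g|%N = (p * q)%N)
    (far : (minn m n).-root (q%:R : R[i]) < min_dist theta xi \/
           (minn m n).-root (q%:R : R[i]) < min_dist_inv theta xi) :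
  irreducible_poly (map_poly intr f : {poly rat}) /\
  irreducible_poly (map_poly intr g : {poly rat}).
Proof.
have f_neq0 : f != 0 by rewrite -size_poly_gt0 deg_f.
have g_neq0 : g != 0 by rewrite -size_poly_gt0 deg_g.
have sep : separated ((minn m n).-root q%:R) theta xi.
  move: roots_neq0; rewrite mulf_eq0 negb_or !prodf_seq_neq0.
  move=> /andP[/allP theta_neq0 /allP xi_neq0].
  case: far => far; [left | right] => x y theta_x xi_y.
    apply: (lt_le_trans far); apply: seq_min_le; last exact: allpairs_f.
    by move=> _ /allpairsP[z [_ _ ->]]; apply: normr_real.
  split; [exact: theta_neq0 | exact: xi_neq0 |].
  apply: (lt_le_trans far); apply: seq_min_le; last first.
    exact: (allpairs_f (fun x y => `|x^-1 - y^-1|)).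
  by move=> _ /allpairsP[z [_ _ ->]]; apply: normr_real.
have k_gt0 : (0 < minn m n)%N by rewrite leq_min m_gt0.
split.
  apply: (irreducible_of_separated _ g_neq0 roots_f roots_g _ p_prime q_gt0 _
            sep).
  - by rewrite deg_f.
  - by rewrite k_gt0 size_tuple geq_minl.
  - by rewrite -(norm_resultantC f_neq0 g_neq0 roots_f roots_g).
apply: (irreducible_of_separated _ f_neq0 roots_g roots_f _ p_prime q_gt0 _
          (separated_sym sep)) => //.
- by rewrite deg_g.
- by rewrite k_gt0 size_tuple geq_minr.
Qed.
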